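(* Let $T$ be an integer with $|T|>11$, let $\vartheta$ be a root of the polynomial $f(x)=x^8+(4T^4+2)x^4+1$, let $K=\mathbb{Q}(\vartheta)$, let $M=\mathbb{Q}(i)$ with ring of integers $\mathbb{Z}_M=\mathbb{Z}[i]$, and let $\mathcal{O}=\mathbb{Z}_M[\vartheta]$, an order of $K$. Then $\mathcal{O}$ admits no power integral bases.
   Context: The field $M=\mathbb{Q}(i)$ is a subfield of $K$. The order $\mathcal{O}$ admits a power integral basis if there exists $\alpha\in\mathcal{O}$ with $\mathcal{O}=\mathbb{Z}[\alpha]$. *)

(* Defs.v *)
(* Number fields are taken as subfields of the field algC of algebraic complex
   numbers; subsets of algC are Prop-valued predicates. *)
From HB Require Import structures.
From mathcomp Require Import all_boot all_order all_algebra all_field.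

Set Implicit Arguments.
Unset Strict Implicit.
Unset Printing Implicit Defensive.

Import Order.TTheory GRing.Theory Num.Theory.
Local Open Scope ring_scope.

(* A[x] for a subring A of R.  When A is a field and x is algebraic over A
   (which always holds in algC) this is also the field A(x). *)
Definition adjoin (R : comNzRingType) (A : R -> Prop) (x : R) : R -> Prop :=
  fun y => exists2 p : {poly R}, (forall k, A p`_k) & y = p.[x].

Definition Zadjoin (x : algC) : algC -> Prop :=
  adjoin (fun z : algC => z \in Num.int) x.

Definition Qadjoin (x : algC) : algC -> Prop :=
  adjoin (fun z : algC => z \in Crat) x.

Definition ring_of_integers (F : algC -> Prop) : algC -> Prop :=
  fun z => F z /\ z \in Aint.

Definition admits_power_integral_basis (O : algC -> Prop) : Prop :=
  exists2 alpha : algC, O alpha & forall y, O y <-> Zadjoin alpha y.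

Definition f_poly (T : int) : {poly int} :=
  'X^8 + (4 * T ^+ 4 + 2) *: 'X^4 + 1.

(* Main.v *)
Require Import Defs.
From HB Require Import structures.
From mathcomp Require Import all_boot all_order all_algebra all_field.
From mathcomp Require Import ring zify.

Import Order.TTheory GRing.Theory Num.Theory.
Local Open Scope ring_scope.

(** Already O/2O cannot be generated by one element, because the prime of O
above 2 has a cotangent space of dimension 2.

Over Z[i] the octic f splits as the product of the two quartics
x^4 + 2itx^2 + 1 with t = T^2 and t = -T^2, so theta is a root of one of
them.  This quartic is irreducible over Q(i) as soon as t is nonzero: its
splitting would make t^2 + 1 the square of a rational number
([quartic_free]).  The elements of Z_M are the Gaussian integers
([gaussInt_coord]), so O is the ring Z[X,Y]/(X^2 + 1, Y^4 + 2tXY^2 + 1), with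
X and Y standing for i and theta ([bieval_ker]).  Modulo 2 both relations
are congruent to powers, (X + 1)^2 and (Y + 1)^4.  Hence F(1,1) and the two
partial derivatives of F at (1,1), all taken modulo 2, depend only on the
element F(i, theta) of O ([alongX_ker], [alongY_ker]).

Suppose that O = Z[alpha] with alpha = F(i, theta), and write i = P(alpha),
theta = R(alpha) with P and R in Z[x].  Modulo 2, the chain rule at (1,1)
gives
  P' F_X = 1,  P' F_Y = 0,  R' F_X = 0,  R' F_Y = 1,
so that 1 = (P' F_X)(R' F_Y) = (P' F_Y)(R' F_X) = 0
([bieval_not_monogenic]).

Nonzero t is essential: for t = 0 the number theta is a primitive eighth root
of unity and O = Z[theta]. *)

(** * Rational square roots of t^2 + 1 *)

Lemma sqr_add1_not_sqr_int (t m : int) : t != 0 -> m ^+ 2 <> t ^+ 2 + 1.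
Proof.
move=> t0 e.
have l0 : (0 < `|t|)%N by rewrite absz_gt0.
have k2 : (`|m| * `|m| = `|t| * `|t| + 1)%N.
  by move: e; rewrite !expr2; clear; nia.
move: k2 l0; move: `|m|%N `|t|%N; clear=> k l k2 l0.
have kl : (l < k)%N by nia.
by have := leq_mul kl kl; nia.
Qed.

Lemma sqr_add1_not_sqr (t : int) (x : algC) :
  t != 0 -> x \in Crat -> x ^+ 2 <> t%:~R ^+ 2 + 1.
Proof.
move=> t0 xQ xE.
have /intrP[m mE]: x \in Num.int.
  apply: Cint_rat_Aint => //.
  apply: (@root_monic_Aint (map_poly intr ('X^2 - (t ^+ 2 + 1)%:P))).
  - rewrite /root rmorphB /= map_polyXn map_polyC /= !hornerE xE.
    by rewrite rmorphD rmorphXn /= subrr.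
  - by apply: monic_map; apply: monicXnsubC.
  - by apply/polyOverP => k; rewrite coef_map intr_int.
apply: (@sqr_add1_not_sqr_int t m t0); apply: (@intr_inj algC).
by rewrite rmorphXn rmorphD rmorphXn /= -mE xE.
Qed.

Ltac rpred_ring := repeat first
  [ exact: rpred_nat | exact: rpred1 | apply: rpredB | apply: rpredD
  | apply: rpredM | apply: rpredX | by [] ].

(** * Gaussian rationals and Gaussian integers *)

Definition gaussRat : {pred algC} :=
  fun z => ('Re z \in Crat) && ('Im z \in Crat).

Lemma gaussRatP z :
  reflect (exists2 x, x \in Crat & exists2 y, y \in Crat & z = x + 'i * y)
    (z \in gaussRat).
Proof.
apply: (iffP andP) => [[xQ yQ]|[x xQ [y yQ ->]]].
  by exists ('Re z) => //; exists ('Im z) => //; exact: Crect.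
by rewrite Re_rect ?Im_rect ?Creal_Crat.
Qed.

Lemma normCK_gaussRat z : z \in gaussRat -> z * z^* \in Crat.
Proof.
case/andP=> xQ yQ; rewrite -normCK normC2_Re_Im.
by rewrite rpredD ?rpredX.
Qed.

Fact gaussRat_divring_closed : divring_closed gaussRat.
Proof.
split=> [|u v /gaussRatP[a aQ [b bQ ->]] /gaussRatP[c cQ [d dQ ->]]|].
- apply/gaussRatP; exists 1; rewrite ?rpred1 //; exists 0; rewrite ?rpred0 //.
  by rewrite mulr0 addr0.
- apply/gaussRatP; exists (a - c); rewrite ?rpredB //.
  by exists (b - d); rewrite ?rpredB //; ring.
move=> u v /gaussRatP[a aQ [b bQ ->]] vQ.
have [-> | v0] := eqVneq v 0.
  rewrite invr0 mulr0; apply/gaussRatP; exists 0; rewrite ?rpred0 //.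
  by exists 0; rewrite ?rpred0 // mulr0 addr0.
have nQ := normCK_gaussRat _ vQ.
have -> : (a + 'i * b) / v = (a + 'i * b) * v^* / (v * v^*).
  by field; rewrite v0 conjC_eq0 v0.
case/gaussRatP: vQ nQ => c cQ [d dQ ->] nQ; set n := _ * _^* in nQ *.
rewrite rmorphD rmorphM /= conjCi (conj_Crat cQ) (conj_Crat dQ).
apply/gaussRatP; exists ((a * c + b * d) / n).
  by rewrite rpred_div // rpredD ?rpredM.
exists ((b * c - a * d) / n); first by rewrite rpred_div // rpredB ?rpredM.
rewrite !mulrA -mulrDl; congr (_ / _).
by have := @sqrCi algC; rewrite expr2 => ii; ring: ii.
Qed.
HB.instance Definition _ :=
  GRing.isDivringClosed.Build _ gaussRat gaussRat_divring_closed.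

Lemma gaussRat_i : 'i \in gaussRat.
Proof.
apply/gaussRatP; exists 0; rewrite ?rpred0 //.
by exists 1; rewrite ?rpred1 // mulr1 add0r.
Qed.

Lemma gaussRat_int (m : int) : m%:~R \in gaussRat.
Proof. exact: rpred_int. Qed.

Lemma Qadjoin_i_gaussRat z : Qadjoin 'i z -> z \in gaussRat.
Proof.
case=> p pQ ->; rewrite horner_coef rpred_sum // => k _.
by rewrite rpredM ?rpredX ?gaussRat_i // rpred_Crat.
Qed.

Lemma Aint_i : 'i \in Aint.
Proof.
apply: (@Aint_unity_root 4) => //; apply/unity_rootP.
by rewrite (exprM _ 2 2) sqrCi sqrrN expr1n.
Qed.

(** If x + iy is integral then so are its trace 2x, the trace 2y of its
product by -i, and its norm x^2 + y^2.  Thus 2x and 2y are integers whose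
squares add up to a multiple of 4, which forces both to be even. *)
Lemma gaussInt_coord z : ring_of_integers (Qadjoin 'i) z ->
  exists x y : int, z = x%:~R + 'i * y%:~R.
Proof.
case=> /Qadjoin_i_gaussRat/gaussRatP[x xQ [y yQ ->]] zA.
have zcE : (x + 'i * y)^* = x - 'i * y.
  by rewrite rmorphD rmorphM /= conjCi !conj_Crat // mulNr.
have zcA : x - 'i * y \in Aint by rewrite -zcE Aint_aut.
have ii := @sqrCi algC.
have /intrP[a aE] : 2 * x \in Num.int.
  apply: Cint_rat_Aint; first by rewrite rpredM ?rpred_nat.
  have -> : 2 * x = (x + 'i * y) + (x - 'i * y) by ring.
  exact: rpredD.
have /intrP[b bE] : 2 * y \in Num.int.
  apply: Cint_rat_Aint; first by rewrite rpredM ?rpred_nat.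
  have -> : 2 * y = 'i * ((x - 'i * y) - (x + 'i * y)) by ring: ii.
  exact: rpredM Aint_i (rpredB zcA zA).
have /intrP[n nE] : x ^+ 2 + y ^+ 2 \in Num.int.
  apply: Cint_rat_Aint; first by rewrite rpredD ?rpredX.
  have -> : x ^+ 2 + y ^+ 2 = (x + 'i * y) * (x - 'i * y) by ring: ii.
  exact: rpredM.
have abn : a ^+ 2 + b ^+ 2 = 4 * n.
  apply: (@intr_inj algC); rewrite intrM rmorphD !rmorphXn /= -aE -bE -nE.
  by ring.
have [a2 b2] : a = 2 * (a %/ 2)%Z /\ b = 2 * (b %/ 2)%Z.
  move: abn; rewrite !expr2 => abn.
  have two0 : (2 : int) != 0 by [].
  have two_gt0 : (0 : int) < 2 by [].
  have := divz_eq a 2; have := divz_eq b 2.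
  have := modz_ge0 a two0; have := ltz_pmod a two_gt0.
  have := modz_ge0 b two0; have := ltz_pmod b two_gt0.
  move: (a %/ 2)%Z (a %% 2)%Z (b %/ 2)%Z (b %% 2)%Z => qa ra qb rb ??????.
  have [?|?] : ra = 0 \/ ra = 1 by lia.
    have [?|?] : rb = 0 \/ rb = 1 by lia.
      lia.
    by subst; nia.
  have [?|?] : rb = 0 \/ rb = 1 by lia.
    by subst; nia.
  by subst; nia.
exists (a %/ 2)%Z, (b %/ 2)%Z.
have two0 : (2 : algC) != 0 by rewrite pnatr_eq0.
congr (_ + 'i * _); apply: (mulfI two0); rewrite ?aE ?bE.
  by rewrite {1}a2 rmorphM.
by rewrite {1}b2 rmorphM.
Qed.

(** * Irreducibility of x^4 + 2itx^2 + 1 over Q(i) *)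

(** For z = x + iy with a real square, xy = 0; x = 0 gives y^2 = t^2 + 1,
and y = 0 makes the square nonnegative. *)
Lemma gaussRat_sqr_neq (t : int) z :
  t != 0 -> z \in gaussRat -> z ^+ 2 <> - (t%:~R ^+ 2 + 1).
Proof.
move=> t0 /gaussRatP[x xQ [y yQ ->]]; set c : algC := t%:~R => e.
have cQ : c \in Crat by rewrite /c rpred_int.
have cR : c \in Creal by exact: Creal_Crat.
have ii := @sqrCi algC.
have e' : (x ^+ 2 - y ^+ 2 + c ^+ 2 + 1) + 'i * (2 * x * y) = 0.
  have -> : (x ^+ 2 - y ^+ 2 + c ^+ 2 + 1) + 'i * (2 * x * y)
    = (x + 'i * y) ^+ 2 + (c ^+ 2 + 1) by ring: ii.
  by rewrite e addNr.
have re0 : 'Re ((x ^+ 2 - y ^+ 2 + c ^+ 2 + 1) + 'i * (2 * x * y)) = 0.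
  by rewrite e' raddf0.
have im0 : 'Im ((x ^+ 2 - y ^+ 2 + c ^+ 2 + 1) + 'i * (2 * x * y)) = 0.
  by rewrite e' raddf0.
have Q1 : x ^+ 2 - y ^+ 2 + c ^+ 2 + 1 \in Crat.
  by rpred_ring.
have Q2 : 2 * x * y \in Crat by rpred_ring.
rewrite Re_rect ?Creal_Crat // in re0.
rewrite Im_rect ?Creal_Crat // in im0.
move/eqP: im0; rewrite !mulf_eq0 pnatr_eq0 /= => /orP[] /eqP z0.
  apply: (@sqr_add1_not_sqr t y t0 yQ); apply/eqP.
  by rewrite -subr_eq0 -oppr_eq0; apply/eqP; rewrite -[RHS]re0 z0 /c; ring.
have : 0 < x ^+ 2 + c ^+ 2 + 1.
  by rewrite ltr_wpDl ?ltr01 ?addr_ge0 ?real_exprn_even_ge0 ?Creal_Crat.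
have -> : x ^+ 2 + c ^+ 2 + 1 = 0 by rewrite -[RHS]re0 z0; ring.
by rewrite ltxx.
Qed.

(** The norm of 2e - 2it from Q(i) to Q is 4(t^2 + 1) when e is 1 or -1; were
2e - 2it a square, its norm would be the square of a rational number. *)
Lemma gaussRat_sqr_mul_eq0 (t : int) (e z n : algC) :
    t != 0 -> e ^+ 2 = 1 -> e^* = e -> z \in gaussRat -> n \in gaussRat ->
  z ^+ 2 * (2 * e - 2 * 'i * t%:~R) = n ^+ 2 -> n = 0.
Proof.
move=> t0 e1 eR zQ nQ zn; apply/eqP/negPn/negP => n0.
have z0 : z != 0.
  apply: contra_neq n0 => z0; move/esym/eqP: zn.
  by rewrite z0 expr0n mul0r sqrf_eq0 => /eqP.
have ii := @sqrCi algC.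
have := congr1 Num.conj zn.
rewrite !(rmorphM, rmorphB, rmorphXn) /= eR conjCi rmorph_nat rmorph_int => zn'.
apply: (@sqr_add1_not_sqr t (n * n^* / (2 * (z * z^*))) t0).
  have zQ1 := normCK_gaussRat _ zQ; have nQ1 := normCK_gaussRat _ nQ.
  by apply: rpred_div => //; apply: rpredM => //; exact: rpred_nat.
have zz0 : z^* != 0 by rewrite conjC_eq0.
rewrite expr_div_n [(n * _) ^+ 2]exprMn -zn [n^* ^+ 2]expr2 -zn'.
apply: (canLR (mulfK _)); last by ring: e1 ii.
by rewrite expf_neq0 ?mulf_neq0 ?pnatr_eq0.
Qed.

(** The discriminant of s^2 + 2its + 1 is -4(t^2 + 1), so that s does not lie
in Q(i). *)
Lemma quad_free (t : int) (s u v : algC) :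
    t != 0 -> s ^+ 2 + 2 * 'i * t%:~R * s + 1 = 0 ->
    u \in gaussRat -> v \in gaussRat -> u + v * s = 0 ->
  u = 0 /\ v = 0.
Proof.
move=> t0 sE uQ vQ uv0; have ii := @sqrCi algC.
have [v0 | v0] := eqVneq v 0; first by move: uv0; rewrite v0 mul0r addr0.
case: (@gaussRat_sqr_neq t (- u / v + 'i * t%:~R) t0).
  by rewrite rpredD ?rpred_div ?rpredN ?rpredM ?gaussRat_i ?gaussRat_int.
have -> : - u / v = s.
  apply: (mulIf v0); rewrite divfK // [s * v]mulrC; apply/eqP.
  by rewrite eq_sym -addr_eq0 addrC uv0.
rewrite -[RHS]addr0 -sE; ring: ii.
Qed.

(** With s = theta^2, a relation reads (a0 + a2 s) + theta (a1 + a3 s) = 0.  If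
it is nontrivial then theta lies in Q(i, s), so s = (U/n + (V/n) s)^2 for some
U, V, n in Q(i).  Comparing coefficients in the basis 1, s gives U^2 = V^2 and
2UV - 2itV^2 = n^2, hence V^2 (2e - 2it) = n^2 where U = eV and e is 1 or -1. *)
Lemma quartic_free (t : int) (theta a0 a1 a2 a3 : algC) :
    t != 0 -> theta ^+ 4 + 2 * 'i * t%:~R * theta ^+ 2 + 1 = 0 ->
    [&& a0 \in gaussRat, a1 \in gaussRat, a2 \in gaussRat & a3 \in gaussRat] ->
    a0 + a1 * theta + a2 * theta ^+ 2 + a3 * theta ^+ 3 = 0 ->
  [/\ a0 = 0, a1 = 0, a2 = 0 & a3 = 0].
Proof.
move=> t0 thE /and4P[Q0 Q1 Q2 Q3] a_th.
have [iQ cQ] := (gaussRat_i, gaussRat_int t).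
have ii := @sqrCi algC.
(* s' is the conjugate of s over Q(i) *)
pose s := theta ^+ 2; pose s' := - (2 * 'i * t%:~R) - s.
have sE : s ^+ 2 + 2 * 'i * t%:~R * s + 1 = 0 by rewrite -[RHS]thE /s; ring.
have sE' : s' ^+ 2 + 2 * 'i * t%:~R * s' + 1 = 0.
  by rewrite -[RHS]sE /s'; ring.
have sM : s ^+ 2 = - (2 * 'i * t%:~R * s + 1).
  by apply/eqP; rewrite -addr_eq0 addrA sE.
have PQ : (a0 + a2 * s) + theta * (a1 + a3 * s) = 0.
  by rewrite -[RHS]a_th /s; ring.
have [Q0' | Qn0] := eqVneq (a1 + a3 * s) 0.
  have [-> ->] := quad_free _ _ _ _ t0 sE Q1 Q3 Q0'.
  move: PQ; rewrite Q0' mulr0 addr0.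
  by move=> /(quad_free _ _ _ _ t0 sE Q0 Q2)[-> ->].
exfalso.
have Q'n0 : a1 + a3 * s' != 0.
  apply: contra_neq Qn0 => /(quad_free _ _ _ _ t0 sE' Q1 Q3)[-> ->].
  by rewrite mul0r addr0.
(* n is the norm of a1 + a3 s, and U + V s = (a0 + a2 s) (a1 + a3 s') *)
pose n := a1 ^+ 2 - 2 * 'i * t%:~R * a1 * a3 + a3 ^+ 2.
have nE : n = (a1 + a3 * s) * (a1 + a3 * s') by rewrite /n /s'; ring: sM.
have n0 : n != 0 by rewrite nE mulf_neq0.
pose U := a0 * a1 - 2 * 'i * t%:~R * a0 * a3 + a2 * a3.
pose V := a1 * a2 - a0 * a3.
have nQ : n \in gaussRat by rpred_ring.
have UQ : U \in gaussRat by rpred_ring.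
have VQ : V \in gaussRat by rpred_ring.
have UVE : U + V * s = - (theta * n).
  rewrite nE; have -> : U + V * s = (a0 + a2 * s) * (a1 + a3 * s').
    by rewrite /U /V /s'; ring: sM.
  by rewrite mulrA -(addr0_eq PQ) mulNr opprK.
have [UV nUV] : U ^+ 2 - V ^+ 2 = 0 /\
    2 * U * V - 2 * 'i * t%:~R * V ^+ 2 - n ^+ 2 = 0.
  apply: (quad_free _ _ _ _ t0 sE).
  - by rpred_ring.
  - by rpred_ring.
  have : (U + V * s) ^+ 2 - s * n ^+ 2 = 0 by rewrite UVE /s; ring.
  by move=> <-; ring: sM.
move/eqP: n0; apply.
move/eqP: UV; rewrite subr_eq0 eqf_sqr => /orP[] /eqP UV.
  apply: (@gaussRat_sqr_mul_eq0 t 1 V); rewrite ?expr1n ?rmorph1 //.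
  by apply/eqP; rewrite -subr_eq0 -nUV UV; apply/eqP; ring.
apply: (@gaussRat_sqr_mul_eq0 t (-1) V);
  rewrite ?sqrrN ?expr1n ?rmorphN1 //.
by apply/eqP; rewrite -subr_eq0 -nUV UV; apply/eqP; ring.
Qed.

(** * The order as a quotient of Z[X,Y] *)

(** Z[X][Y]: the inner variable X stands for i, the outer one Y for theta. *)
Notation bipoly := {poly {poly int}}.

Definition bieval (theta : algC) : bipoly -> algC :=
  horner_eval theta \o map_poly (horner_eval 'i \o map_poly intr).
HB.instance Definition _ theta := GRing.RMorphism.on (bieval theta).

Definition quarticXY (t : int) : bipoly :=
  'X^4 + (2 * t%:~R * 'X)%:P * 'X^2 + 1.

Lemma bievalC theta p : bieval theta p%:P = (map_poly intr p).['i].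
Proof. by rewrite /bieval /= map_polyC /horner_eval hornerC. Qed.

Lemma bievalY theta : bieval theta 'X = theta.
Proof. by rewrite /bieval /= map_polyX /horner_eval hornerX. Qed.

Lemma bievalX theta : bieval theta 'X%:P = 'i.
Proof. by rewrite bievalC map_polyX hornerX. Qed.

Lemma bieval_quarticXY t theta :
  bieval theta (quarticXY t) = theta ^+ 4 + 2 * 'i * t%:~R * theta ^+ 2 + 1.
Proof.
rewrite /quarticXY rmorphD rmorphD rmorphXn [X in _ + X + _]rmorphM rmorphXn.
rewrite /= bievalY bievalC rmorph1 rmorphM /= map_polyX hornerMX.
rewrite rmorphM rmorph_nat rmorph_int /= hornerM hornerMn hornerC.
by rewrite -polyCMz hornerC; ring.
Qed.

Lemma size_quarticXY_tail t :
  (size ((2 * t%:~R * 'X)%:P * 'X^2 + 1 : bipoly)%R < 5)%N.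
Proof.
rewrite (leq_ltn_trans (size_polyD _ _)) // size_poly1 gtn_max andbT.
rewrite (leq_ltn_trans (size_polyMleq _ _)) // size_polyXn.
by rewrite addn3 /= !ltnS size_polyC; case: (_ == _).
Qed.

Lemma quarticXY_monic t : quarticXY t \is monic.
Proof.
rewrite /quarticXY -addrA monicE lead_coefDl ?size_polyXn ?lead_coefXn //.
exact: size_quarticXY_tail.
Qed.

Lemma size_quarticXY t : size (quarticXY t) = 5%N.
Proof.
rewrite /quarticXY -addrA size_polyDl ?size_polyXn //.
exact: size_quarticXY_tail.
Qed.

Lemma int_poly_root_i (p : {poly int}) :
  (map_poly intr p).['i : algC] = 0 -> exists q, p = q * ('X^2 + 1).
Proof.
have mon : ('X^2 + 1 : {poly int}) \is monic by exact: monicXnaddC.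
have sz : size ('X^2 + 1 : {poly int}) = 3%N by exact: size_XnaddC.
rewrite (Pdiv.RingMonic.rdivp_eq mon p); set q := Pdiv.Ring.rdivp _ _.
set r := Pdiv.Ring.rmodp _ _.
have r2 : (size r <= 2)%N.
  by rewrite -ltnS -sz Pdiv.Ring.ltn_rmodpN0 ?monic_neq0.
rewrite rmorphD rmorphM /= rmorphD rmorphXn rmorph1 /= map_polyX.
rewrite !hornerE sqrCi addNr mulr0 add0r.
rewrite (horner_coef_wide _ (leq_trans (size_poly _ _) r2)).
rewrite !big_ord_recl big_ord0 !coef_map /= expr0 mulr1 expr1 addr0 => r0.
have [Re0 Im0] : r`_0 = 0 /\ r`_1 = 0.
  move: r0; rewrite mulrC => r0; split; apply: (@intr_inj algC).
    have := congr1 (fun z : algC => 'Re z) r0.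
    by rewrite /= Re_rect ?raddf0 ?Rreal_int.
  have := congr1 (fun z : algC => 'Im z) r0.
  by rewrite /= Im_rect ?raddf0 ?Rreal_int.
exists q; rewrite -[RHS]addr0; congr (_ + _); apply/polyP => -[|[|k]].
- by rewrite coef0.
- by rewrite coef0.
by rewrite nth_default ?coef0 // (leq_trans r2).
Qed.

Lemma poly_size4 (R : nzRingType) (p : {poly R}) : (size p <= 4)%N ->
  p = (p`_0)%:P + (p`_1)%:P * 'X + (p`_2)%:P * 'X^2 + (p`_3)%:P * 'X^3.
Proof.
move=> p4; apply/polyP=> -[|[|[|[|k]]]];
  rewrite !coefD !coefC coefMX !coefMXn !coefC /= ?addr0 ?add0r //.
by rewrite nth_default // (leq_trans p4).
Qed.

(** Division by the monic [quarticXY t] leaves a remainder of degree at most 3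
in Y; its coefficients vanish at X = i because 1, theta, theta^2, theta^3 are
independent over Q(i). *)
Lemma bieval_ker (t : int) (theta : algC) (F : bipoly) :
    t != 0 -> theta ^+ 4 + 2 * 'i * t%:~R * theta ^+ 2 + 1 = 0 ->
    bieval theta F = 0 ->
  exists A B, F = A * quarticXY t + B * ('X^2 + 1)%:P.
Proof.
move=> t0 thE; have mon := quarticXY_monic t.
rewrite (Pdiv.RingMonic.rdivp_eq mon F).
set q := Pdiv.Ring.rdivp _ _; set r := Pdiv.Ring.rmodp _ _.
have r4 : (size r <= 4)%N.
  by rewrite -ltnS -(size_quarticXY t) Pdiv.Ring.ltn_rmodpN0 ?monic_neq0.
rewrite rmorphD rmorphM /= bieval_quarticXY thE mulr0 add0r => r0.
have coefQ k : (map_poly intr r`_k).['i : algC] \in gaussRat.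
  rewrite horner_coef rpred_sum // => l _; rewrite coef_map.
  by apply: rpredM; [exact: gaussRat_int | exact: rpredX gaussRat_i].
have [] : [/\ (map_poly intr r`_0).['i : algC] = 0,
              (map_poly intr r`_1).['i : algC] = 0,
              (map_poly intr r`_2).['i : algC] = 0 &
              (map_poly intr r`_3).['i : algC] = 0].
  apply: (@quartic_free t theta _ _ _ _ t0 thE); first by rewrite !coefQ.
  rewrite -{}r0 [in RHS](poly_size4 _ _ r4) !rmorphD !rmorphM /=.
  by rewrite !bievalC bievalY.
move=> /int_poly_root_i[p0 r0E] /int_poly_root_i[p1 r1E].
move=> /int_poly_root_i[p2 r2E] /int_poly_root_i[p3 r3E].
exists q, (p0%:P + p1%:P * 'X + p2%:P * 'X^2 + p3%:P * 'X^3).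
congr (_ + _); rewrite (poly_size4 _ _ r4) r0E r1E r2E r3E !polyCM.
by ring.
Qed.

Lemma adjoin_bieval (theta z : algC) :
    adjoin (ring_of_integers (Qadjoin 'i)) theta z ->
  exists F, bieval theta F = z.
Proof.
case=> p pZM ->; rewrite horner_coef.
elim/big_ind: _ => [|_ _ [F <-] [G <-]|k _].
- by exists 0; rewrite rmorph0.
- by exists (F + G); rewrite rmorphD.
have [x [y ->]] := gaussInt_coord _ (pZM k).
exists ((x%:~R + 'X * y%:~R)%:P * 'X^k).
rewrite rmorphM rmorphXn /= bievalY bievalC rmorphD rmorphM /= !rmorph_int.
by rewrite map_polyX !hornerE -!polyCMz !hornerC.
Qed.

(** * First-order behaviour modulo 2 at the point (1,1) *)

(** F(X,1) modulo 2: its derivative at 1 is the partial derivative of F with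
respect to X at (1,1).  Restricting to a line keeps this a ring morphism into
univariate polynomials, where the chain rule is available. *)
Definition alongX : bipoly -> {poly 'F_2} := map_poly intr \o horner_eval 1.
HB.instance Definition _ := GRing.RMorphism.on alongX.

(** F(1,Y) modulo 2. *)
Definition alongY : bipoly -> {poly 'F_2} := map_poly (intr \o horner_eval 1).
HB.instance Definition _ := GRing.RMorphism.on alongY.

Lemma alongX_alongY_1 F : (alongX F).[1] = (alongY F).[1].
Proof.
transitivity (F.[1].[1]%:~R : 'F_2).
  have := horner_map (intr : int -> 'F_2) F.[1] 1.
  by rewrite /= rmorph1.
have := horner_map (intr \o horner_eval (1 : int) : {poly int} -> 'F_2) F 1.
by rewrite /= /horner_eval hornerC => ->.
Qed.

Lemma two_F2 : (2 : 'F_2) = 0.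
Proof. by apply/val_inj. Qed.

(** Modulo 2 and at Y = 1 the quartic vanishes, while X^2 + 1 = (X + 1)^2 has
a double root at 1. *)
Lemma alongX_ker (t : int) (A B : bipoly) :
  (alongX (A * quarticXY t + B * ('X^2 + 1)%:P))^`().[1] = 0.
Proof.
have G0 : alongX (quarticXY t) = 0.
  have -> : alongX (quarticXY t)
            = map_poly intr (2 * (1 + t%:~R * 'X) : {poly int}).
    rewrite /alongX /quarticXY /= /horner_eval !hornerE !expr1n.
    by congr map_poly; rewrite /= !mulr1; ring.
  by rewrite rmorphM rmorph_nat -polyCMn two_F2 mul0r.
have XE : alongX ('X^2 + 1)%:P = 'X^2 + 1.
  by rewrite /alongX /= /horner_eval hornerC rmorphD /= map_polyXn rmorph1.
rewrite rmorphD !rmorphM /= G0 XE mulr0 add0r derivM !derivE !hornerE expr1n.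
by ring: two_F2.
Qed.

(** Modulo 2 and at X = 1 the quartic becomes Y^4 + 1 = (Y + 1)^4, while
X^2 + 1 vanishes. *)
Lemma alongY_ker (t : int) (A B : bipoly) :
  (alongY (A * quarticXY t + B * ('X^2 + 1)%:P))^`().[1] = 0.
Proof.
have CE p : alongY p%:P = (p.[1]%:~R)%:P by rewrite /alongY map_polyC.
have X0 : alongY ('X^2 + 1)%:P = 0.
  have e2 : ('X^2 + 1 : {poly int}).[1] = 2 by rewrite !hornerE expr1n.
  by rewrite CE e2 -[_%:~R]/(2 : 'F_2) two_F2.
have GE : alongY (quarticXY t) = 'X^4 + 1.
  rewrite /quarticXY rmorphD rmorphD rmorphXn [X in _ + X + _]rmorphM /= CE.
  rewrite rmorph1 [alongY 'X]map_polyX.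
  rewrite !hornerM hornerMn hornerC hornerX -polyCMz hornerC /= mulr1.
  by rewrite rmorphM rmorph_nat two_F2 !mul0r addr0.
rewrite rmorphD !rmorphM /= GE X0 mulr0 addr0 derivM !derivE !hornerE !expr1n.
rewrite /=; transitivity (2 * ((alongY A)^`().[1] + 2 * (alongY A).[1]) : 'F_2).
  by ring.
by rewrite two_F2 mul0r.
Qed.

Lemma deriv_horner_int (P : {poly int}) (f : {poly 'F_2}) :
  (map_poly intr P).[f]^`().[1]
    = (map_poly (intr : int -> 'F_2) P)^`().[f.[1]] * f^`().[1].
Proof.
have -> : map_poly intr P = map_poly polyC (map_poly (intr : int -> 'F_2) P).
  by rewrite -map_poly_comp; apply: eq_map_poly => m /=; rewrite rmorph_int.
by rewrite -/(comp_poly _ _) deriv_comp hornerM horner_comp.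
Qed.

Lemma horner_int_rmorph (R S : nzRingType) (h : {rmorphism R -> S})
    (P : {poly int}) x :
  h (map_poly intr P).[x] = (map_poly intr P).[h x].
Proof.
rewrite -horner_map -map_poly_comp; congr _.[_].
by apply: eq_map_poly => m /=; rewrite rmorph_int.
Qed.

(** * Orders without power integral basis *)

Lemma Zadjoin_int_poly (alpha z : algC) :
  Zadjoin alpha z -> exists P : {poly int}, z = (map_poly intr P).[alpha].
Proof.
case=> p pZ ->; have /floorpP[P ->] : p \is a polyOver Num.int by apply/polyOverP.
by exists P.
Qed.

(** Both i and theta being polynomials in a single element would make the rank
one matrix with entries P' F_X, P' F_Y, R' F_X, R' F_Y the identity over
F_2. *)
Lemma bieval_not_monogenic (t : int) (theta : algC) (F : bipoly)
    (P R : {poly int}) :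
    t != 0 -> theta ^+ 4 + 2 * 'i * t%:~R * theta ^+ 2 + 1 = 0 ->
    (map_poly intr P).[bieval theta F] = 'i ->
  (map_poly intr R).[bieval theta F] <> theta.
Proof.
move=> t0 thE PE RE.
(* the chain rule along both lines, whose common base point is F(1,1) *)
have chain Q G : (map_poly intr Q).[bieval theta F] = bieval theta G ->
    let Q' := (map_poly (intr : int -> 'F_2) Q)^`() in
    (alongX G)^`().[1] = Q'.[(alongX F).[1]] * (alongX F)^`().[1] /\
    (alongY G)^`().[1] = Q'.[(alongX F).[1]] * (alongY F)^`().[1].
  rewrite -horner_int_rmorph => QG.
  have /(bieval_ker _ _ _ t0 thE)[A [B AB]] :
    bieval theta (G - (map_poly intr Q).[F]) = 0 by rewrite rmorphB QG subrr.
  have := alongX_ker t A B; have := alongY_ker t A B.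
  rewrite -AB !rmorphB /= !derivB !hornerD !hornerN !horner_int_rmorph.
  by rewrite !deriv_horner_int alongX_alongY_1; split; apply/subr0_eq.
have [px py] := chain P 'X%:P (etrans PE (esym (bievalX theta))).
have [rx ry] := chain R 'X (etrans RE (esym (bievalY theta))).
have XX : (alongX 'X%:P)^`().[1] = 1.
  by rewrite /alongX /= /horner_eval hornerC map_polyX derivX hornerC.
have XY : (alongX 'X)^`().[1] = 0.
  by rewrite /alongX /= /horner_eval hornerX rmorph1 derivC horner0.
have YX : (alongY 'X%:P)^`().[1] = 0.
  by rewrite /alongY map_polyC derivC horner0.
have YY : (alongY 'X)^`().[1] = 1.
  by rewrite /alongY map_polyX derivX hornerC.
have := congr2 *%R px ry.
rewrite mulrACA [X in _ = _ * X]mulrC mulrACA -py -rx XX XY YX YY.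
by rewrite mulr1 mulr0 => /eqP; rewrite oner_eq0.
Qed.

Theorem quartic_order_not_monogenic (t : int) (theta : algC) :
    t != 0 -> theta ^+ 4 + 2 * 'i * t%:~R * theta ^+ 2 + 1 = 0 ->
  ~ admits_power_integral_basis (adjoin (ring_of_integers (Qadjoin 'i)) theta).
Proof.
move=> t0 thE [alpha /adjoin_bieval[F FE] gen].
have ZM_int (m : int) : ring_of_integers (Qadjoin 'i) m%:~R.
  split; last exact: Aint_int.
  exists m%:~R%:P; rewrite ?hornerC // => k.
  by rewrite coefC; case: eqP; rewrite ?rpred0 ?rpred_int.
have ZM_i : ring_of_integers (Qadjoin 'i) 'i.
  split; last exact: Aint_i.
  by exists 'X; rewrite ?hornerX // => k; rewrite coefX rpred_nat.
have /gen/Zadjoin_int_poly[P PE] :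
    adjoin (ring_of_integers (Qadjoin 'i)) theta 'i.
  exists 'i%:P; rewrite ?hornerC // => k.
  by rewrite coefC; case: eqP => // _; exact: ZM_int 0.
have /gen/Zadjoin_int_poly[R RE] :
    adjoin (ring_of_integers (Qadjoin 'i)) theta theta.
  exists 'X; rewrite ?hornerX // => k; rewrite coefX.
  by case: eqP => // _; [exact: ZM_int 1 | exact: ZM_int 0].
by apply: (@bieval_not_monogenic t theta F P R); rewrite // FE.
Qed.

Theorem theorem5 (T : int) (theta : algC)
    (hT : 11 < `|T|)
    (htheta : root (map_poly (intr : int -> algC) (f_poly T)) theta) :
  let M := Qadjoin 'i in
  let ZM := ring_of_integers M in
  let O := adjoin ZM theta in
  ~ admits_power_integral_basis O.
Proof.
move=> M ZM O.
have T0 : T != 0 by apply: contraTneq hT => ->; rewrite normr0.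
have ii := @sqrCi algC.
have [] : theta ^+ 4 + 2 * 'i * (T ^+ 2)%:~R * theta ^+ 2 + 1 = 0 \/
          theta ^+ 4 + 2 * 'i * (- T ^+ 2)%:~R * theta ^+ 2 + 1 = 0.
- (* f = (x^4 + 1)^2 - (2iT^2 x^2)^2 *)
  have : (theta ^+ 4 + 2 * 'i * (T ^+ 2)%:~R * theta ^+ 2 + 1) *
         (theta ^+ 4 + 2 * 'i * (- T ^+ 2)%:~R * theta ^+ 2 + 1) = 0.
    move: htheta; rewrite /root /f_poly => /eqP <-.
    rewrite !rmorphD /= map_polyZ /= !map_polyXn rmorph1 !hornerE.
    rewrite rmorphN rmorphD rmorphM !rmorphXn /=.
    by ring: ii.
  by move/eqP; rewrite mulf_eq0 => /orP[] /eqP; [left | right].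
- by apply: quartic_order_not_monogenic; rewrite expf_neq0.
- by apply: quartic_order_not_monogenic; rewrite oppr_eq0 expf_neq0.
Qed.
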